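(* Let $X\subseteq\mathbb{R}$, $S\subseteq X$, and let $f_n,f:X\to\mathbb{C}$, where $(f_n)_{n\in\mathbb{N}}$ is a sequence of functions. Then the following are equivalent: (a) $(f_n)$ converges uniformly to $f$ on $S$. (b) For all $x\in{}^*S$ and all $n\in{}^*\mathbb{N}\setminus\mathbb{N}$, ${}^*f_n(x)\approx{}^*f(x)$.
   Context: $\mathbb{R}_+$ is the set of positive real numbers and $\mathbb{N}=\{1,2,3,\dots\}$. Fix an ultrafilter $\mathcal{U}$ on $\mathbb{R}_+$ such that $(0,\tfrac1n)\in\mathcal{U}$ for all $n\in\mathbb{N}$. A property of $\varepsilon\in\mathbb{R}_+$ holds almost everywhere (a.e.) if the set of $\varepsilon$ for which it holds belongs to $\mathcal{U}$. For nets $(a_\varepsilon),(b_\varepsilon)\in\mathbb{C}^{\mathbb{R}_+}$ write $(a_\varepsilon)\sim(b_\varepsilon)$ if $a_\varepsilon=b_\varepsilon$ a.e.; $\langle a_\varepsilon\rangle$ is the equivalence class, and ${}^*\mathbb{C}=\mathbb{C}^{\mathbb{R}_+}/\!\sim$ with operations induced pointwise; $\mathbb{C}$ is embedded via constant nets; $|\langle z_\varepsilon\rangle|=\langle|z_\varepsilon|\rangle$. For $A\subseteq\mathbb{C}$, ${}^*A=\{\langle s_\varepsilon\rangle : s_\varepsilon\in A\text{ a.e.}\}$; this defines ${}^*\mathbb{N}$, ${}^*S$, ${}^*X$ and ${}^*\mathbb{R}$, the last ordered by $\langle a_\varepsilon\rangle<\langle b_\varepsilon\rangle$ iff $a_\varepsilon<b_\varepsilon$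 a.e. For $n=\langle n_\varepsilon\rangle\in{}^*\mathbb{N}$ and $x=\langle x_\varepsilon\rangle\in{}^*X$ (representatives chosen with $n_\varepsilon\in\mathbb{N}$, $x_\varepsilon\in X$ for all $\varepsilon$), ${}^*f_n(x)=\langle f_{n_\varepsilon}(x_\varepsilon)\rangle$ and ${}^*f(x)=\langle f(x_\varepsilon)\rangle$. $z\in{}^*\mathbb{C}$ is infinitesimal if $|z|<\tfrac1m$ for all $m\in\mathbb{N}$; $a\approx b$ means $a-b$ is infinitesimal. *)

(* Defs.v *)
(* MathComp / MathComp-Analysis, with R[i] from mathcomp-real-closed. *)
From HB Require Import structures.
From mathcomp Require Import all_boot all_order all_algebra.
From mathcomp Require Import complex.
From mathcomp Require Import all_classical all_reals all_analysis.

Set Implicit Arguments.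
Unset Strict Implicit.
Unset Printing Implicit Defensive.

Import Order.TTheory GRing.Theory Num.Theory.
Import numFieldNormedType.Exports.

Local Open Scope classical_set_scope.
Local Open Scope ring_scope.
Local Open Scope complex_scope.
Local Open Scope quotient_scope.

Section Hypercomplex.
Context {R : realType} {U : set_system {posnum R}} (hU : UltraFilter U).

Local Notation net := ({posnum R} -> R[i]).

Definition ae_eq (a b : net) : bool := `[< \forall e \near U, a e = b e >].

Lemma ae_eq_refl : reflexive ae_eq.
Proof. by move=> a; apply/asboolP; exact: nearW. Qed.

Lemma ae_eq_sym : symmetric ae_eq.
Proof.
by move=> a b; apply/asboolP/asboolP; apply: filterS => e ->.
Qed.

Lemma ae_eq_trans : transitive ae_eq.
Proof.
move=> b a c /asboolP ab /asboolP bc; apply/asboolP.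
by apply: filterS2 ab bc => e -> ->.
Qed.

Definition ae_equiv := EquivRel ae_eq ae_eq_refl ae_eq_sym ae_eq_trans.

Definition hyperC : Type := {eq_quot ae_equiv}.
HB.instance Definition _ := EqQuotient.on hyperC.
HB.instance Definition _ := Choice.on hyperC.

Definition hclass (a : net) : hyperC := \pi_hyperC a.

Lemma hclassP (a b : net) :
  hclass a = hclass b <-> \forall e \near U, a e = b e.
Proof.
split; first by move=> /eqquotP /asboolP.
by move=> ab; apply/eqquotP/asboolP.
Qed.

Lemma hclass_repr (z : hyperC) : hclass (repr z) = z.
Proof. exact: reprK. Qed.

Lemma near_repr (a : net) : \forall e \near U, repr (hclass a) e = a e.
Proof. by apply/hclassP; exact: hclass_repr. Qed.

Definition hconst (c : R[i]) : hyperC := hclass (fun=> c).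

Definition hzero : hyperC := hconst 0.
Definition hopp (a : hyperC) : hyperC := hclass (fun e => - repr a e).
Definition hadd (a b : hyperC) : hyperC :=
  hclass (fun e => repr a e + repr b e).

Lemma hoppE (a : net) : hopp (hclass a) = hclass (fun e => - a e).
Proof. by apply/hclassP; apply: filterS (near_repr a) => e ->. Qed.

Lemma haddE (a b : net) :
  hadd (hclass a) (hclass b) = hclass (fun e => a e + b e).
Proof.
by apply/hclassP; apply: filterS2 (near_repr a) (near_repr b) => e -> ->.
Qed.

Lemma haddA : associative hadd.
Proof.
move=> a b c; rewrite -(hclass_repr a) -(hclass_repr b) -(hclass_repr c).
by rewrite !haddE; congr hclass; apply/funext => e; rewrite addrA.
Qed.

Lemma haddC : commutative hadd.
Proof. by move=> a b; congr hclass; apply/funext => e; rewrite addrC. Qed.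

Lemma hadd0 : left_id hzero hadd.
Proof.
move=> a; rewrite -(hclass_repr a) haddE.
by congr hclass; apply/funext => e; rewrite add0r.
Qed.

Lemma haddN : left_inverse hzero hopp hadd.
Proof.
move=> a; rewrite -(hclass_repr a) hoppE haddE.
by congr hclass; apply/funext => e; rewrite addNr.
Qed.

HB.instance Definition _ := GRing.isZmodule.Build hyperC haddA haddC hadd0 haddN.

(* As in R[i], the modulus is valued in the complex type itself. *)
Definition habs (z : hyperC) : hyperC := hclass (fun e => `|repr z e|).

Lemma habsE (a : net) : habs (hclass a) = hclass (fun e => `|a e|).
Proof. by apply/hclassP; apply: filterS (near_repr a) => e ->. Qed.

(* The order of R[i] extends that of R and relates only numbers with the same
   imaginary part; its ultrapower hlt restricts to the usual order on the
   hyperreals, where all the values of habs lie. *)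
Definition hlt (a b : hyperC) : Prop := \forall e \near U, repr a e < repr b e.

Lemma hltE (a b : net) :
  hlt (hclass a) (hclass b) <-> \forall e \near U, a e < b e.
Proof.
split; apply: filterS3 (near_repr a) (near_repr b) => e.
  by move=> -> ->.
by move=> <- <-.
Qed.

Definition infinitesimal (z : hyperC) : Prop :=
  forall m : nat, (0 < m)%N -> hlt (habs z) (hconst m%:R^-1).

Definition infinitely_close (a b : hyperC) : Prop := infinitesimal (a - b).

Definition star (A : set R[i]) : set hyperC :=
  [set z | exists2 s : net, z = hclass s & \forall e \near U, A (s e)].

(* Below, A is typically a set of naturals or of reals, and i its embedding
   into R[i]. *)
Lemma star_net (T : Type) (i : T -> R[i]) (A : set T) (z : star (i @` A)) :
  exists t : {posnum R} -> A, val z = hclass (i \o val \o t).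
Proof.
case: z => z /= /set_mem [s -> sA].
have [e0 [t0 At0 _]] := filter_ex sA.
have tP e : exists t : A, (i @` A) (s e) -> i (val t) = s e.
  have [[t At <-]|nA] := pselect ((i @` A) (s e)).
    by exists (SigSub (mem_set At)).
  by exists (SigSub (mem_set At0)).
have [t tE] := choice tP; exists t.
by apply/hclassP; apply: filterS sA => e /tE /= ->.
Qed.

(* A choice, for each z in the star of i @` A, of a representative all of whose
   values come from A. *)
Definition rep (T : Type) (i : T -> R[i]) (A : set T) (z : star (i @` A)) :
  {posnum R} -> A := projT1 (cid (star_net z)).

Lemma repE (T : Type) (i : T -> R[i]) (A : set T) (z : star (i @` A)) :
  hclass (i \o val \o rep z) = val z.
Proof. by rewrite /rep; case: cid. Qed.

Lemma near_rep (T : Type) (i : T -> R[i]) (A : set T) (z : star (i @` A))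
    (t : {posnum R} -> A) : injective i ->
  val z = hclass (i \o val \o t) -> \forall e \near U, rep z e = t e.
Proof.
move=> i_inj; rewrite -repE => /hclassP.
by apply: filterS => e /= /i_inj /val_inj.
Qed.

Definition natC (n : nat) : R[i] := n%:R.

Definition realC (x : R) : R[i] := x%:C.

Definition posN : set nat := [set n | (0 < n)%N].

Definition starN : set hyperC := star (natC @` posN).

Definition starR (A : set R) : set hyperC := star (realC @` A).

Definition stdN : set hyperC := [set hconst (natC n) | n in posN].

Definition star_fun (X : set R) (f : X -> R[i]) (x : starR X) : hyperC :=
  hclass (fun e => f (rep x e)).

(* A sequence indexed by the positive integers is a nat-indexed one whose term
   f_ 0 is irrelevant: rep n takes its values in posN. *)
Definition star_seq (X : set R) (f_ : nat -> X -> R[i]) (n : starN)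
    (x : starR X) : hyperC :=
  hclass (fun e => f_ (val (rep n e)) (rep x e)).

Lemma natC_inj : injective natC.
Proof. by move=> m n /eqP; rewrite eqr_nat => /eqP. Qed.

Lemma realC_inj : injective realC.
Proof. by move=> x y []. Qed.

Lemma star_funE (X : set R) (f : X -> R[i]) (x : starR X)
    (t : {posnum R} -> X) :
  val x = hclass (realC \o val \o t) -> star_fun f x = hclass (f \o t).
Proof.
move=> /(near_rep realC_inj) xt.
by apply/hclassP; apply: filterS xt => e /= ->.
Qed.

Lemma star_seqE (X : set R) (f_ : nat -> X -> R[i]) (n : starN) (x : starR X)
    (k : {posnum R} -> posN) (t : {posnum R} -> X) :
  val n = hclass (natC \o val \o k) -> val x = hclass (realC \o val \o t) ->
  star_seq f_ n x = hclass (fun e => f_ (val (k e)) (t e)).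
Proof.
move=> /(near_rep natC_inj) nk /(near_rep realC_inj) xt.
by apply/hclassP; apply: filterS2 nk xt => e /= -> ->.
Qed.

End Hypercomplex.

Arguments hclass {R U} hU a.
Arguments hconst {R U} hU c.
Arguments star {R U} hU A _.
Arguments starN {R U} hU _.
Arguments starR {R U} hU A _.
Arguments stdN {R U} hU _.

(* Main.v *)
(* If the convergence is uniform with rank N for the tolerance 1/m, then an
   infinite n has n_e >= N almost everywhere, whence the infinitesimality of the
   difference. Conversely, a failure of uniformity for the tolerance 1/m yields
   k(N) > N and x(N) in S at which the difference is at least 1/m; evaluating
   both along N = floor(1/e), which is unbounded modulo the ultrafilter, gives an
   infinite n and a point of *S violating (b). *)
Require Import Defs.
From HB Require Import structures.
From mathcomp Require Import all_boot all_order all_algebra.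
From mathcomp Require Import complex.
From mathcomp Require Import all_classical all_reals all_analysis.

Set Implicit Arguments.
Unset Strict Implicit.
Unset Printing Implicit Defensive.

Import Order.TTheory GRing.Theory Num.Theory.
Import numFieldNormedType.Exports.

Local Open Scope classical_set_scope.
Local Open Scope ring_scope.
Local Open Scope complex_scope.

(** A positive element of [R[i]] has imaginary part zero, so this is the Archimedean property of
    [R]. *)
Lemma complex_archi (R : realType) (z : R[i]) :
  0 < z -> exists2 m : nat, (0 < m)%N & m%:R^-1 < z.
Proof.
case: z => a b; rewrite ltcE /= => /andP[/eqP -> a0].
exists (Num.truncn a^-1).+1 => //.
rewrite -[(a +i* 0)](_ : a%:C = _) // -[(_.+1)%:R](rmorph_nat (real_complex R)).
rewrite -[_^-1](fmorphV (real_complex R)) ltcR invf_plt ?posrE//.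
exact: truncnS_gt.
Qed.

(** The entourages of [R[i]^o] come from balls whose radii are positive elements of [R[i]]; by
    [complex_archi] the radii 1/m are cofinal among them. *)
Lemma uniform_cvg_complexP (R : realType) (T : choiceType) (A : set T)
    (I : Type) (F : set_system I) (FF : Filter F)
    (f_ : I -> T -> R[i]^o) (f : T -> R[i]^o) :
  {uniform A, f_ @ F --> f} <->
  forall m : nat, (0 < m)%N ->
    \forall n \near F, forall x, A x -> `|f_ n x - f x| < m%:R^-1.
Proof.
split=> [cvgf m m0|cvgf P /uniform_nbhs[E [entE /filterS]]].
  apply: (cvgf [set h | forall x, A x -> `|h x - f x| < m%:R^-1]).
  apply/uniform_nbhs.
  exists [set xy : R[i]^o * R[i]^o | ball xy.1 m%:R^-1 xy.2]; split.
    by rewrite -entourage_from_ballE; exists m%:R^-1 => //=; rewrite invr_gt0 ltr0n.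
  by move=> h hE x /hE /=; rewrite -ball_normE /= distrC.
apply; move: entE; rewrite -entourage_from_ballE => -[e /= e0 eE].
have [m m0 me] := complex_archi e0.
apply: filterS (cvgf m m0) => n fn x /fn fnx.
by apply: eE; rewrite /= -ball_normE /= distrC (lt_trans fnx).
Qed.

Section Hypercomplex.
Context {R : realType} {U : set_system {posnum R}} (hU : UltraFilter U).

Lemma infinitely_closeE (a b : {posnum R} -> R[i]) :
  infinitely_close (hclass hU a) (hclass hU b) <->
  forall m : nat, (0 < m)%N -> \forall e \near U, `|a e - b e| < m%:R^-1.
Proof.
rewrite /infinitely_close /infinitesimal.
have -> : hclass hU a - hclass hU b = hclass hU (fun e => a e - b e).
  by rewrite -[LHS]/(hadd _ (hopp _)) hoppE haddE.
by rewrite habsE; split=> ab m /ab; [move/hltE|move=> ?; apply/hltE].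
Qed.

(** [rep x] is only chosen with values in [X], but it agrees almost everywhere with a representative
    lying in [S]. *)
Lemma near_rep_starR (X S : set R) (x : starR hU X) :
  val x \in starR hU S -> \forall e \near U, S (val (rep x e)).
Proof.
move=> /set_mem[s xs sS].
have /hclassP := etrans (repE x) xs.
by apply: filterS2 sS => e [r Sr <-] /= /realC_inj ->.
Qed.

(** Induction on [N]: the ultrafilter decides whether [rep n] equals [N.+1] almost everywhere, which
    would make [n] standard, or differs from it almost everywhere, which improves the bound by
    one. *)
Lemma near_rep_nonstandard (n : starN hU) (N : nat) :
  val n \notin stdN hU -> \forall e \near U, (N < val (rep n e))%N.
Proof.
move=> nstd; elim: N => [|N IH].
  by apply: nearW => e; exact: (set_mem (valP (rep n e))).
have [nN|] := in_ultra_setVsetC [set e | val (rep n e) = N.+1] hU.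
  case/negP: nstd; apply/mem_set; exists N.+1 => //.
  rewrite -(repE n); apply/esym/hclassP.
  by apply: filterS nN => e /= ->.
by apply: filterS2 IH => e /= Nn /eqP; rewrite ltn_neqAle eq_sym Nn andbT.
Qed.

Lemma notin_stdN (k : {posnum R} -> nat) :
  (forall N, \forall e \near U, (N < k e)%N) ->
  hclass hU (@natC R \o k) \notin stdN hU.
Proof.
move=> kU; apply/negP => /set_mem[N _ /hclassP Nk].
have [e [/= /natC_inj -> ]] := filter_ex (filterI Nk (kU N)).
by rewrite ltnn.
Qed.

Lemma near_truncn_inv :
  (forall n : nat, (0 < n)%N -> U [set e | e%:num < n%:R^-1]) ->
  forall N, \forall e \near U, (N < Num.truncn (e%:num^-1 : R))%N.
Proof.
(* If e < 1/(N+1), then 1/e > N+1, so its integer part exceeds [N]. *)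
move=> U0 N; apply: filterS (U0 N.+1 isT) => e /= eN.
by rewrite truncn_gt_nat -[leLHS]invrK lef_pV2 ?posrE ?invr_gt0// ltW.
Qed.

End Hypercomplex.

Theorem theorem4p6p2 (R : realType) (U : set_system {posnum R})
    (hU : UltraFilter U)
    (hU0 : forall n : nat, (0 < n)%N -> U [set e | e%:num < n%:R^-1])
    (X S : set R) (SX : S `<=` X)
    (f_ : nat -> X -> R[i]^o) (f : X -> R[i]^o) :
  {uniform [set x : X | S (val x)], f_ @ \oo --> f} <->
  (forall x : starR hU X, val x \in starR hU S ->
   forall n : starN hU, val n \notin stdN hU ->
   infinitely_close (star_seq f_ n x) (star_fun f x)).
Proof.
rewrite uniform_cvg_complexP; split.
  move=> cvgf x xS n nstd; apply/infinitely_closeE => m /cvgf[N _ fN].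
  apply: filterS2 (near_rep_starR xS) (near_rep_nonstandard N nstd) => e Sx Nn.
  exact: fN (ltnW Nn) _ Sx.
move=> closef m m0; apply: contrapT => ncvg.
have /choice[kx kxP] : forall N, exists kx : nat * X,
    [/\ (N < kx.1)%N, S (val kx.2) & ~ `|f_ kx.1 kx.2 - f kx.2| < m%:R^-1].
  move=> N; apply: contrapT => nkx; apply: ncvg.
  (* Starting at [N.+1] makes the bad index strictly larger than [N], hence positive even for [N] =
     0, as membership in [posN] requires. *)
  exists N.+1 => // k /= Nk x Sx; apply: contrapT => fkx.
  by apply: nkx; exists (k, x).
pose N (e : {posnum R}) := Num.truncn (e%:num^-1 : R).
have k_gt0 e : (kx (N e)).1 \in posN.
  by apply/mem_set; case: (kxP (N e)) => /(leq_trans _) + _ _; exact.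
pose k e : posN := SigSub (k_gt0 e).
pose t e := (kx (N e)).2.
have nP : starN hU (hclass hU (@natC R \o val \o k)).
  exists (@natC R \o val \o k) => //; apply: nearW => e /=.
  by exists (val (k e)) => //; exact: (set_mem (valP (k e))).
have xP : starR hU X (hclass hU (@realC R \o val \o t)).
  exists (@realC R \o val \o t) => //; apply: nearW => e /=.
  by exists (val (t e)) => //; exact: (set_mem (valP (t e))).
have xS : hclass hU (@realC R \o val \o t) \in starR hU S.
  apply/mem_set; exists (@realC R \o val \o t) => //; apply: nearW => e /=.
  by exists (val (t e)) => //; case: (kxP (N e)).
have nstd : hclass hU (@natC R \o val \o k) \notin stdN hU.
  apply: notin_stdN => M; apply: filterS (near_truncn_inv hU hU0 M) => e /= MN.
  by case: (kxP (N e)) => /(ltn_trans MN).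
pose n : starN hU := SigSub (mem_set nP).
pose x : starR hU X := SigSub (mem_set xP).
have := closef x xS n nstd.
rewrite (star_seqE f_ (erefl : val n = _) (erefl : val x = _)).
rewrite (star_funE f (erefl : val x = _)) => /infinitely_closeE/(_ m m0).
(* A set of the ultrafilter is nonempty, so a single e with difference below 1/m already contradicts
   the choice of [kx]. *)
by case/filter_ex => e /=; case: (kxP (N e)).
Qed.
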